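(* Let $G$ be a connected weighted graph on $n$ vertices, where each edge weight is a positive definite matrix of order $s$, and let $R$ be the resistance matrix of $G$. Then the inertia of $R$ is $(s,\,ns-s,\,0)$, i.e., $R$ has exactly $s$ positive eigenvalues, $ns-s$ negative eigenvalues and no zero eigenvalue.
   Context: $G$ is a simple graph with vertex set $\{1,\dots,n\}$; each edge $\{i,j\}$ carries a weight $W_{i,j}=W_{j,i}$, a real $s\times s$ positive definite matrix; $j\sim i$ means adjacency. The Laplacian $L$ is the $ns\times ns$ block matrix with $(i,i)$ block $\sum_{j\sim i}W_{i,j}^{-1}$, $(i,j)$ block ($i\ne j$) equal to $-W_{i,j}^{-1}$ if $i\sim j$ and $0$ otherwise. Writing $K_{i,j}$ for the $s\times s$ blocks of the Moore--Penrose inverse $L^\dagger$, the resistance matrix $R$ is the $ns\times ns$ block matrix with blocks $R_{i,j}=K_{i,i}+K_{j,j}-2K_{i,j}$. The inertia of a symmetric matrix is the triple (number of positive, number of negative, number of zero eigenvalues).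
   Formalization: The graph is assumed to have at least two vertices (n ≥ 2); for n = 1 the resistance matrix is the zero matrix of order s, with inertia (0,0,s), so the claim as written fails there. *)

(* Defs.v *)
From HB Require Import structures.
From mathcomp Require Import all_boot all_order all_algebra.
From mathcomp Require Import reals.

Set Implicit Arguments.
Unset Strict Implicit.
Unset Printing Implicit Defensive.

Import Order.TTheory GRing.Theory Num.Theory.
Local Open Scope ring_scope.

Definition posdefmx (R : realType) (m : nat) (A : 'M[R]_m) : Prop :=
  A^T = A /\ forall x : 'cV[R]_m, x != 0 -> 0 < (x^T *m A *m x) 0 0.

Definition is_mpinv (R : realType) (m n : nat)
    (A : 'M[R]_(m, n)) (X : 'M[R]_(n, m)) : Prop :=
  [/\ A *m X *m A = A, X *m A *m X = X,
      (A *m X)^T = A *m X & (X *m A)^T = X *m A].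

(* MacDuffee's formula: if A = C F with C of full column rank and F of full
   row rank, the Moore-Penrose inverse is F^T (F F^T)^-1 (C^T C)^-1 C^T.
   The lemmas mpinvP and is_mpinv_uniq characterize it by the Penrose
   equations. *)
Definition mpinv (R : realType) (m n : nat) (A : 'M[R]_(m, n)) : 'M[R]_(n, m) :=
  let C := col_base A in let F := row_base A in
  F^T *m invmx (F *m F^T) *m (invmx (C^T *m C) *m C^T).

Lemma row_free_gram_unit (R : realType) (m n : nat) (A : 'M[R]_(m, n)) :
  row_free A -> A *m A^T \in unitmx.
Proof.
move=> Afree; rewrite -row_free_unit -kermx_eq0; apply/eqP/row_matrixP => i.
rewrite row0; set v := row i _.
have v0 : v *m (A *m A^T) = 0.
  by apply/sub_kermxP; rewrite row_sub.
have /matrixP /(_ 0 0) : (v *m A) *m (v *m A)^T = 0.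
  by rewrite trmx_mul !mulmxA -(mulmxA v) v0 mul0mx.
rewrite !mxE => /eqP; rewrite psumr_eq0 => [/allP vA0|j _]; last first.
  by rewrite [X in _ * X]mxE -expr2 sqr_ge0.
apply: (row_free_inj Afree); rewrite mul0mx; apply/rowP => j.
have := vA0 j (mem_index_enum _).
by rewrite [X in _ * X]mxE -expr2 sqrf_eq0 => /eqP ->; rewrite mxE.
Qed.

Lemma mpinvP (R : realType) (m n : nat) (A : 'M[R]_(m, n)) :
  is_mpinv A (mpinv A).
Proof.
rewrite /mpinv /=; have := mulmx_base A.
have := col_base_full A; have := row_base_free A.
move: (\rank A) (col_base A) (row_base A) => r C F Ffree Cfull defA.
have uF := row_free_gram_unit Ffree.
have uC : C^T *m C \in unitmx.
  rewrite -{2}[C]trmxK; apply: row_free_gram_unit.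
  by rewrite /row_free mxrank_tr.
set Fi := invmx _; set Ci := invmx _.
have sF : Fi^T = Fi by rewrite trmx_inv trmx_mul trmxK.
have sC : Ci^T = Ci by rewrite trmx_inv trmx_mul trmxK.
have AX : A *m (F^T *m Fi *m (Ci *m C^T)) = C *m Ci *m C^T.
  by rewrite -defA -!mulmxA (mulmxA F) (mulmxA (F *m F^T)) mulmxV ?mul1mx.
have XA : F^T *m Fi *m (Ci *m C^T) *m A = F^T *m Fi *m F.
  by rewrite -defA -!mulmxA (mulmxA C^T) (mulmxA Ci) mulVmx ?mul1mx.
split.
- by rewrite AX -defA -!mulmxA (mulmxA C^T) (mulmxA Ci) mulVmx ?mul1mx.
- by rewrite XA -!mulmxA (mulmxA F) (mulmxA (F *m F^T)) mulmxV ?mul1mx.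
- by rewrite AX !trmx_mul trmxK sC mulmxA.
- by rewrite XA !trmx_mul trmxK sF mulmxA.
Qed.

Lemma is_mpinv_uniq (R : realType) (m n : nat) (A : 'M[R]_(m, n))
    (X Y : 'M[R]_(n, m)) : is_mpinv A X -> is_mpinv A Y -> X = Y.
Proof.
move=> [X1 X2 X3 X4] [Y1 Y2 Y3 Y4].
have AXY : A *m X = A *m Y.
  by rewrite -X3 -[in LHS]Y1 -[A *m Y *m A *m X]mulmxA trmx_mul X3 Y3 mulmxA X1.
have XYA : X *m A = Y *m A.
  rewrite -X4 -[in LHS]Y1 -[A *m Y *m A]mulmxA (mulmxA X) trmx_mul X4 Y4.
  by rewrite -mulmxA (mulmxA A) X1.
by rewrite -X2 XYA -mulmxA AXY mulmxA Y2.
Qed.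

(* [weight i j] is only meaningful when [i] and [j] are adjacent. *)
Record weighted_graph (R : realType) (n s : nat) := WeightedGraph {
  adj : rel 'I_n;
  weight : 'I_n -> 'I_n -> 'M[R]_s;
  adj_irrefl : irreflexive adj;
  adj_sym : symmetric adj;
  weight_sym : forall i j, adj i j -> weight i j = weight j i;
  weight_posdef : forall i j, adj i j -> posdefmx (weight i j) }.

Definition connected_graph (R : realType) (n s : nat)
    (G : weighted_graph R n s) : Prop :=
  forall i j : 'I_n, connect (adj G) i j.

(* An ns x ns block matrix has the type of [\mxblock], whose size is written
   \sum_(i < n) s. *)
Definition laplacian (R : realType) (n s : nat) (G : weighted_graph R n s) :
    'M[R]_(\sum_(i < n) s) :=
  \mxblock_(i < n, j < n)
    (if i == j then \sum_(k < n | adj G i k) invmx (weight G i k)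
     else if adj G i j then - invmx (weight G i j) else 0).

Definition resistance (R : realType) (n s : nat) (G : weighted_graph R n s) :
    'M[R]_(\sum_(i < n) s) :=
  let K (i j : 'I_n) : 'M[R]_s := submxblock (mpinv (laplacian G)) i j in
  \mxblock_(i < n, j < n) (K i i + K j j - 2%:R *: K i j).

(* [e] lists the eigenvalues of A, each repeated according to its multiplicity
   as a root of the characteristic polynomial.  It is unique up to permutation,
   so A has at most one inertia. *)
Definition has_inertia (R : realType) (m : nat) (A : 'M[R]_m)
    (inertia : nat * nat * nat) : Prop :=
  exists2 e : seq R, char_poly A = \prod_(x <- e) ('X - x%:P) &
    inertia = (count (fun x => 0 < x) e, count (fun x => x < 0) e,
               count (fun x => x == 0) e).

(* Main.v *)
Require Import Defs.
From mathcomp Require Import all_boot all_order all_algebra.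
From mathcomp Require Import reals.
From mathcomp Require Import complex zify.

(** Let [U] be the stack of [n] identity blocks, [D] the block column of the
    [K i i], and [K] the Moore-Penrose inverse of the Laplacian.  Then
    [R = D U^T + U D^T - 2 K].  By connectedness the kernel of [L], hence that
    of [K], is the range of [U], so [R] coincides with the negative definite
    form [- 2 K] on the orthogonal complement of that range, of dimension
    [ns - s].  On the range of [U] itself, [U^T R U = 2 n (\sum_i K i i)] is
    positive definite, because for [n > 1] no nonzero vector supported on one
    vertex is in the kernel of [K].  As the dimensions add up to [ns], the
    spectral theorem gives the inertia. *)

Set Implicit Arguments.
Unset Strict Implicit.
Unset Printing Implicit Defensive.
Import Order.TTheory GRing.Theory Num.Theory.
Local Open Scope ring_scope.
Local Open Scope complex_scope.
Local Open Scope sesquilinear_scope.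

(** * Counting eigenvalue signs from definite subspaces *)

(** If [p] exceeded the number of positive entries of [d], some nonzero [z] would make [z *m B]
    vanish at all of their positions, and the form would be at most 0 there. *)
Lemma hermitian_diag_pos_card (C : numClosedFieldType) (p m : nat)
    (d : 'rV[C]_m) (B : 'M[C]_(p, m)) :
  d \is a mxOver Num.real ->
  (forall z : 'rV_p, z != 0 ->
     0 < ((z *m B) *m diag_mx d *m (z *m B)^t*) 0 0) ->
  (p <= #|[pred i : 'I_m | (0 < d 0 i)%R]|)%N.
Proof.
move=> dR Bpos; rewrite leqNgt; apply/negP => cardp.
pose f (j : 'I_#|[pred i : 'I_m | (0 < d 0 i)%R]|) : 'I_m := enum_val j.
have: kermx (colsub f B) != 0.
  rewrite kermx_eq0 /row_free neq_ltn.
  by rewrite (leq_ltn_trans (rank_leq_col _) cardp).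
case/rowV0Pn => z /sub_kermxP zB z0; have := Bpos z z0.
move/lt_geF/negP; apply.
rewrite mul_mx_diag !mxE; apply: sumr_le0 => j _; rewrite !mxE.
rewrite mulrAC -normCK; case: (boolP (0 < d 0 j)) => [dj|dj].
  have jI : j \in [pred i : 'I_m | (0 < d 0 i)%R] by [].
  have /rowP/(_ (enum_rank_in jI j)) := zB.
  rewrite mulmx_colsub !mxE /f enum_rankK_in // => ->.
  by rewrite normr0 expr0n mul0r.
apply: mulr_ge0_le0; first by rewrite exprn_ge0.
by rewrite real_leNgt ?real0 // (mxOverP dR).
Qed.

Local Notation cmx := (map_mx (real_complex _)).

Lemma cmx_trmxC (R : rcfType) (m n : nat) (A : 'M[R]_(m, n)) :
  (cmx A)^t* = (cmx A)^T.
Proof. by apply/matrixP => i j; rewrite !mxE; apply: conjc_real. Qed.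

(** With [z] split into real and imaginary parts, the cross terms cancel by symmetry of [A], which
    leaves the sum of two real forms. *)
Lemma complex_form_gt0 (R : rcfType) (m : nat) (A : 'M[R]_m) :
  A^T = A -> (forall x : 'rV_m, x != 0 -> 0 < (x *m A *m x^T) 0 0) ->
  forall z : 'rV[R[i]]_m, z != 0 -> 0 < (z *m cmx A *m z^t*) 0 0.
Proof.
move=> symA Apos z z0.
pose u := map_mx (@complex.Re R) z; pose v := map_mx (@complex.Im R) z.
have zE : z = cmx u + 'i%C *: cmx v.
  by apply/matrixP => i j; rewrite !mxE -complexE.
have zcE : z^t* = cmx u^T - 'i%C *: cmx v^T.
  apply/matrixP => i j; rewrite !mxE; case: (z j i) => a b /=.
  by simpc.
have cross : u *m A *m v^T = v *m A *m u^T.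
  by rewrite [LHS]mx11_scalar -tr_scalar_mx -mx11_scalar !trmx_mul trmxK symA
    mulmxA.
have -> : z *m cmx A *m z^t* = cmx (u *m A *m u^T + v *m A *m v^T).
  rewrite zcE zE mulmxDl mulmxBr !mulmxDl -!scalemxAl -!scalemxAr.
  rewrite -!map_mxM cross scalerA -expr2 sqr_i scaleN1r map_mxD.
  by rewrite opprB addrACA subrr addr0.
rewrite mxE -[0]/(0%:C) ltcR mxE.
have Age0 (x : 'rV_m) : 0 <= (x *m A *m x^T) 0 0.
  have [->|x0] := eqVneq x 0; first by rewrite !mul0mx mxE.
  exact: ltW (Apos _ x0).
have [u0|u0] := eqVneq u 0; last by rewrite ltr_pwDl ?Apos.
have [v0|v0] := eqVneq v 0; last by rewrite ltr_wpDl ?Apos.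
by move: z0; rewrite zE u0 v0 !map_mx0 scaler0 addr0 eqxx.
Qed.

(** Over [R[i]] the matrix is Hermitian, so its eigenvalues are real. [Q] may stay complex, as only
    the signs in [d] are to be counted. *)
Lemma real_symmetric_spectral (R : rcfType) (m : nat) (A : 'M[R]_m) :
  A^T = A -> exists (Q : 'M[R[i]]_m) (d : 'rV[R]_m),
    Q \is unitarymx /\ cmx A = Q^t* *m diag_mx (cmx d) *m Q.
Proof.
move=> symA.
have herm : cmx A \is hermsymmx.
  apply: realsym_hermsym.
    apply/is_hermitianmxP/matrixP => i j.
    by rewrite expr0 scale1r -[in LHS]symA !mxE.
  by apply/mxOverP => i j; rewrite mxE; apply/complex_realP; exists (A i j).
have dreal := hermitian_spectral_diag_real herm.
exists (spectralmx (cmx A)), (map_mx (@complex.Re R) (spectral_diag (cmx A))).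
split; first exact: spectral_unitarymx.
have -> : cmx (map_mx (@complex.Re R) (spectral_diag (cmx A))) = spectral_diag (cmx A).
  apply/rowP => j; rewrite !mxE; apply: RRe_real.
  exact: (mxOverP dreal).
rewrite -invmx_unitary ?spectral_unitarymx //.
exact/orthomx_spectralP/hermitian_normalmx.
Qed.

Lemma symmetric_pos_card (R : rcfType) (p m : nat) (A : 'M[R]_m)
    (P : 'M[R]_(p, m)) (Q : 'M[R[i]]_m) (d : 'rV[R]_m) :
  A^T = A -> cmx A = Q^t* *m diag_mx (cmx d) *m Q ->
  (forall x : 'rV_p, x != 0 -> 0 < (x *m P *m A *m (x *m P)^T) 0 0) ->
  (p <= #|[pred i : 'I_m | (0 < d 0 i)%R]|)%N.
Proof.
move=> symA AE Apos.
have symPAP : (P *m A *m P^T)^T = P *m A *m P^T.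
  by rewrite !trmx_mul trmxK symA mulmxA.
rewrite (_ : #|_| = #|[pred i : 'I_m | (0 < (cmx d) 0 i)%R]|); last first.
  by apply: eq_card => i; rewrite !inE mxE -[0 in RHS]/(0%:C) ltcR.
apply: (@hermitian_diag_pos_card _ _ _ _ (cmx P *m Q^t*)).
  by apply/mxOverP => i j; rewrite mxE; apply/complex_realP; exists (d i j).
move=> z z0.
have := complex_form_gt0 symPAP _ z0.
rewrite !map_mxM -map_trmx AE => H.
have -> : z *m (cmx P *m Q^t*) *m diag_mx (cmx d) *m
   (z *m (cmx P *m Q^t*))^t* =
   z *m (cmx P *m (Q^t* *m diag_mx (cmx d) *m Q) *m (cmx P)^T) *m z^t*.
  by rewrite !trmx_mul !map_mxM trmxCK cmx_trmxC !mulmxA.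
by apply: H => x x0; have := Apos x x0; rewrite trmx_mul !mulmxA.
Qed.

Lemma char_poly_conj (F : fieldType) (m : nat) (A P : 'M[F]_m) :
  P \in unitmx -> char_poly (invmx P *m A *m P) = char_poly A.
Proof.
move=> Pu; have PPV : map_mx polyC (invmx P) *m map_mx polyC P = 1%:M.
  by rewrite -map_mxM mulVmx ?map_mx1.
rewrite /char_poly.
have -> : char_poly_mx (invmx P *m A *m P) =
    map_mx polyC (invmx P) *m char_poly_mx A *m map_mx polyC P.
  rewrite /char_poly_mx mulmxBr mulmxBl !map_mxM; congr (_ - _).
  by rewrite scalar_mxC -mulmxA PPV mulmx1.
by rewrite !det_mulmx mulrAC -det_mulmx PPV det1 mul1r.
Qed.

Lemma count_sign (R : realDomainType) (e : seq R) :
  (count (fun x => 0 < x)%R e + count (fun x => x < 0)%R e +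
   count (fun x => x == 0)%R e = size e)%N.
Proof.
elim: e => //= x e <-.
by case: (ltgtP x 0) => _; rewrite /= !(add0n, addnS, addSn, add1n).
Qed.

(** At least [p] eigenvalues are positive and at least [q] negative; since there are [p + q] in all,
    both bounds are equalities and none is zero. *)
Lemma inertia_of_definite_subspaces (R : realType) (m p q : nat) (A : 'M[R]_m)
    (P : 'M[R]_(p, m)) (N : 'M[R]_(q, m)) :
  A^T = A -> (p + q = m)%N ->
  (forall x : 'rV_p, x != 0 -> 0 < (x *m P *m A *m (x *m P)^T) 0 0) ->
  (forall x : 'rV_q, x != 0 -> (x *m N *m A *m (x *m N)^T) 0 0 < 0) ->
  has_inertia A (p, q, 0%N).
Proof.
move=> symA pqm Ppos Nneg.
have [Q [d [Qunit AE]]] := real_symmetric_spectral symA.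
have le_p := symmetric_pos_card symA AE Ppos.
have le_q : (q <= #|[pred i : 'I_m | (d 0 i < 0)%R]|)%N.
  have symN : (- A)^T = - A by rewrite linearN /= symA.
  have NE : cmx (- A) = Q^t* *m diag_mx (cmx (- d)) *m Q.
    by rewrite !map_mxN AE linearN /= mulmxN mulNmx.
  rewrite (_ : #|_| = #|[pred i : 'I_m | (0 < (- d) 0 i)%R]|); last first.
    by apply: eq_card => i; rewrite !inE mxE oppr_gt0.
  apply: (symmetric_pos_card (P := N) symN NE) => x x0.
  by rewrite mulmxN mulNmx mxE oppr_gt0 Nneg.
pose e := [seq d 0 i | i <- enum 'I_m].
have charE : char_poly A = \prod_(x <- e) ('X - x%:P).
  (* The factorization is claimed over [R] but the diagonalization lives over [R[i]], so the
     polynomials are compared after the injective embedding. *)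
  apply: (@map_poly_inj _ _ (real_complex R)).
  rewrite map_char_poly AE -invmx_unitary // char_poly_conj ?unitarymx_unit //.
  rewrite char_poly_trig ?diag_mx_is_trig // rmorph_prod /= big_map big_enum /=.
  by apply: eq_bigr => i _; rewrite !mxE eqxx mulr1n map_polyXsubC.
have countE (a : pred R) : count a e = #|[pred i : 'I_m | a (d 0 i)]|.
  by rewrite count_map cardE -size_filter enumT.
exists e => //; have := count_sign e.
rewrite -(countE (fun x => 0 < x)%R) in le_p.
rewrite -(countE (fun x => x < 0)%R) in le_q.
rewrite size_map size_enum_ord -[in RHS]pqm => tot.
move: le_p le_q tot.
move: (count _ e) (count _ e) (count _ e) => a b c le_p le_q tot.
congr (_, _, _); lia.
Qed.

(** * Inverses of positive definite and of symmetric matrices *)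

Lemma posdefmx_unit (R : realType) (m : nat) (A : 'M[R]_m) :
  posdefmx A -> A \in unitmx.
Proof.
move=> [symA Apos]; rewrite -row_free_unit -kermx_eq0.
apply: contraT => /rowV0Pn[x /sub_kermxP xA x0].
have := Apos x^T; rewrite trmxK xA mul0mx mxE ltxx trmx_eq0 => /(_ x0).
by [].
Qed.

Lemma posdefmx_inv (R : realType) (m : nat) (A : 'M[R]_m) :
  posdefmx A -> posdefmx (invmx A).
Proof.
move=> Apd; have Au := posdefmx_unit Apd; case: Apd => symA Apos.
have symV : (invmx A)^T = invmx A by rewrite trmx_inv symA.
split=> // x x0.
have -> : x^T *m invmx A *m x = (invmx A *m x)^T *m A *m (invmx A *m x).
  by rewrite trmx_mul symV -!mulmxA mulKVmx.
apply: Apos; apply: contraNneq x0 => Vx0.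
by rewrite -[x](mulKVmx Au) Vx0 mulmx0.
Qed.

(** Transposition exchanges [A *m X] and [X *m A], hence the last two Penrose equations. With
    uniqueness this makes [mpinv] of a symmetric matrix symmetric. *)
Lemma is_mpinv_trmx (R : realType) (m : nat) (A X : 'M[R]_m) :
  A^T = A -> is_mpinv A X -> is_mpinv A X^T.
Proof.
move=> symA [AXA XAX AXt XAt].
have AXT : A *m X^T = X *m A by rewrite -[RHS]XAt trmx_mul symA.
have XTA : X^T *m A = A *m X by rewrite -[RHS]AXt trmx_mul symA.
split; rewrite ?AXT ?XTA //.
  by rewrite -[RHS]symA -[in RHS]AXA !trmx_mul symA mulmxA AXT.
by rewrite -XTA -[in RHS]XAX !trmx_mul symA mulmxA.
Qed.

(** * The Laplacian, its quadratic form and its kernel *)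

(* Vectors are rows here: [J] is the transpose of the [U] of the header. *)
Section Laplacian.
Variables (R : realType) (n s : nat) (G : weighted_graph R n s).
Notation V i j := (invmx (weight G i j)).
Notation L := (laplacian G).
Notation J := (\mxrow_(i < n) (1%:M : 'M[R]_s)).

(** Degree part minus adjacency part: irreflexivity makes the second vanish on the diagonal, so sums
    over blocks split in two. *)
Lemma laplacianE : L = \mxblock_(i < n, j < n)
  ((if i == j then \sum_(k < n | adj G i k) V i k else 0) -
   (if adj G i j then V i j else 0)).
Proof.
apply: eq_mxblock => i j; case: eqVneq => [->|_].
  by rewrite adj_irrefl subr0.
by rewrite sub0r; case: ifP => // _; rewrite oppr0.
Qed.

Lemma laplacian_sym : L^T = L.
Proof.
rewrite laplacianE tr_mxblock; apply: eq_mxblock => i j.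
have trV k l : adj G k l -> (V k l)^T = V k l.
  by move=> /(@weight_posdef _ _ _ G)/posdefmx_inv[].
rewrite linearB /= eq_sym adj_sym; congr (_ - _).
  case: eqVneq => [->|_]; last by rewrite trmx0.
  by rewrite linear_sum; apply: eq_bigr => k /trV.
case: ifP => [aij|_]; last by rewrite trmx0.
by rewrite trV ?(adj_sym G j) // (weight_sym aij).
Qed.

Lemma mul_ones_laplacian : J *m L = 0.
Proof.
rewrite laplacianE mul_mxrow_mxblock -[RHS]mxrow0; apply: eq_mxrow => j.
under eq_bigr do rewrite mul1mx.
rewrite sumrB -!big_mkcond /= (big_pred1 j) => [|i]; last by rewrite eq_sym.
apply/eqP; rewrite subr_eq0; apply/eqP.
apply: eq_big => i; first by rewrite adj_sym.
by move=> /weight_sym ->.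
Qed.

(** The factor 2 arises because the right-hand side visits each edge in both orientations. *)
Lemma laplacian_form (y : 'rV[R]_(\sum_(i < n) s)) :
  (y *m L *m y^T) *+ 2 =
  \sum_i \sum_(j | adj G i j)
    (submxrow y i - submxrow y j) *m V i j *m (submxrow y i - submxrow y j)^T.
Proof.
pose z i := submxrow y i.
pose S := \sum_i \sum_(j | adj G i j) z i *m V i j *m (z i - z j)^T.
have mulif (b : bool) (x : 'rV[R]_s) (A : 'M_s) :
  x *m (if b then A else 0) = if b then x *m A else 0.
  by case: b; rewrite ?mulmx0.
have SE : y *m L *m y^T = S.
  rewrite -[y]submxrowK tr_mxrow laplacianE mul_mxrow_mxblock mul_mxrow_mxcol.
  rewrite (eq_bigr (fun j => \sum_(k | adj G j k) z j *m V j k *m (z j)^T -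
      \sum_(k | adj G k j) z k *m V k j *m (z j)^T)) => [|j _]; last first.
    under eq_bigr do rewrite mulmxBr !mulif.
    rewrite sumrB -!big_mkcond /= big_pred1_eq.
    by rewrite mulmxBl mulmx_sumr !mulmx_suml.
  rewrite sumrB /= [X in _ - X](exchange_big_dep predT) //= -sumrB.
  apply: eq_bigr => i _; rewrite -sumrB; apply: eq_bigr => j _.
  by rewrite linearB mulmxBr.
(* Exchanging the endpoints of each edge gives a second expression of [S]; adding it to the first
   puts the difference on both sides of the weight. *)
have S'E : S = \sum_i \sum_(j | adj G i j) z j *m V i j *m (z j - z i)^T.
  rewrite /S (exchange_big_dep predT) //=; apply: eq_bigr => j _.
  apply: eq_big => i; first by rewrite adj_sym.
  by move=> /weight_sym ->.
rewrite SE mulr2n {2}S'E -big_split /=; apply: eq_bigr => i _.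
rewrite -big_split /=; apply: eq_bigr => j _.
by rewrite -[z j - z i]opprB linearN mulmxN -mulmxBl -mulmxBl.
Qed.

Lemma edge_form_gt0 (i j : 'I_n) (x : 'rV[R]_s) :
  adj G i j -> x != 0 -> 0 < (x *m V i j *m x^T) 0 0.
Proof.
move=> /(@weight_posdef _ _ _ G)/posdefmx_inv[_ Vpos] x0.
by have := Vpos x^T; rewrite trmxK trmx_eq0; apply.
Qed.

Lemma edge_form_ge0 (i j : 'I_n) (x : 'rV[R]_s) :
  adj G i j -> 0 <= (x *m V i j *m x^T) 0 0.
Proof.
have [->|x0 aij] := eqVneq x 0; first by rewrite !mul0mx mxE.
exact: ltW (edge_form_gt0 aij x0).
Qed.

Lemma laplacian_form_ge0 (y : 'rV[R]_(\sum_(i < n) s)) :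
  0 <= (y *m L *m y^T) 0 0.
Proof.
have := congr1 (fun M : 'M_1 => M 0 0) (laplacian_form y).
rewrite mulmxnE summxE => yLy; rewrite -(pmulrn_lge0 _ (isT : 0 < 2)%N) yLy.
apply: sumr_ge0 => i _; rewrite summxE; apply: sumr_ge0 => j.
exact: edge_form_ge0.
Qed.

Lemma mul_ones_rV (z : 'rV[R]_s) : z *m J = \mxrow_(i < n) z.
Proof. by rewrite mul_mxrow; apply: eq_mxrow => i; rewrite mulmx1. Qed.

Hypotheses (n_gt0 : (0 < n)%N) (G_connected : connected_graph G).

(** Every edge term is nonnegative, so all vanish; definiteness makes [y] agree at adjacent
    vertices, and paths from a base vertex spread the equality. *)
Lemma laplacian_form_eq0 (y : 'rV[R]_(\sum_(i < n) s)) :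
  (y *m L *m y^T) 0 0 = 0 -> exists z, y = z *m J.
Proof.
move=> yLy0; have := congr1 (fun M : 'M_1 => M 0 0) (laplacian_form y).
rewrite mulmxnE yLy0 mul0rn summxE => /esym/eqP.
rewrite psumr_eq0 => [/allP sum0|i _]; last first.
  by rewrite summxE; apply: sumr_ge0 => j; apply: edge_form_ge0.
have adj_eq i j : adj G i j -> submxrow y i = submxrow y j.
  move=> aij; have := sum0 i (mem_index_enum _).
  rewrite summxE psumr_eq0 => [/allP/(_ j (mem_index_enum _))|k]; last first.
    exact: edge_form_ge0.
  rewrite aij /= => /eqP form0; apply/eqP; rewrite -subr_eq0.
  by apply: contraTT isT => /(edge_form_gt0 aij); rewrite form0 ltxx.
exists (submxrow y (Ordinal n_gt0)); rewrite mul_ones_rV -[LHS]submxrowK.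
apply: eq_mxrow => j; have /connectP[p] := G_connected (Ordinal n_gt0) j.
elim: p (Ordinal n_gt0) => [|k p IHp] i /= => [_ -> //|/andP[aik pth] ej].
by rewrite (adj_eq i k aik); apply: IHp.
Qed.

(** * The Moore-Penrose inverse of the Laplacian *)

Notation K := (mpinv L).

Lemma mpinv_laplacian_sym : K^T = K.
Proof.
have LT : is_mpinv L K^T := is_mpinv_trmx laplacian_sym (mpinvP L).
exact: is_mpinv_uniq LT (mpinvP L).
Qed.

Lemma mpinv_laplacianC : L *m K = K *m L.
Proof.
have [_ _ LKt _] := mpinvP L.
by rewrite -LKt trmx_mul laplacian_sym mpinv_laplacian_sym.
Qed.

Lemma mul_ones_mpinv_laplacian : J *m K = 0.
Proof.
have [_ KLK _ _] := mpinvP L.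
by rewrite -KLK -mpinv_laplacianC !mulmxA mul_ones_laplacian !mul0mx.
Qed.

(** From [K = K L K], the form of [K] inherits semidefiniteness from that of [L]. *)
Lemma mpinv_laplacian_formE (y : 'rV[R]_(\sum_(i < n) s)) :
  y *m K *m y^T = (y *m K) *m L *m (y *m K)^T.
Proof.
have [_ KLK _ _] := mpinvP L.
by rewrite trmx_mul mpinv_laplacian_sym -[in LHS]KLK !mulmxA.
Qed.

Lemma mpinv_laplacian_form_gt0 (y : 'rV[R]_(\sum_(i < n) s)) :
  (forall z, y <> z *m J) -> 0 < (y *m K *m y^T) 0 0.
Proof.
move=> yJ; rewrite mpinv_laplacian_formE lt_def laplacian_form_ge0 andbT.
apply/eqP => /laplacian_form_eq0[z yK].
have [LKL _ _ _] := mpinvP L.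
(* As [L] and [K] commute, [y L = y L K L = (y K) L L = z J L L], and [J L = 0]. *)
have yL : y *m L = 0.
  by rewrite -LKL mpinv_laplacianC (mulmxA y) (mulmxA y K) yK -(mulmxA z)
    mul_ones_laplacian mulmx0 mul0mx.
have [|w yw] := @laplacian_form_eq0 y; first by rewrite yL mul0mx mxE.
exact: yJ yw.
Qed.

End Laplacian.

(** * The quadratic form of the resistance matrix *)

Section Resistance.
Variables (R : realType) (n s : nat) (G : weighted_graph R n s).
Notation J := (\mxrow_(i < n) (1%:M : 'M[R]_s)).
Notation K := (mpinv (laplacian G)).
Notation D := (\mxcol_(i < n) submxblock (mpinv (laplacian G)) i i).

Lemma resistanceE : resistance G = D *m J + (D *m J)^T - K *+ 2.
Proof.
rewrite -[K in RHS]submxblockK mul_mxcol_mxrow tr_mxblock mulr2n.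
rewrite -!mxblockD -mxblockB; apply: eq_mxblock => i j.
rewrite !mulmx1 !submxblockK tr_submxblock mpinv_laplacian_sym.
by rewrite scaler_nat mulr2n.
Qed.

Lemma resistance_sym : (resistance G)^T = resistance G.
Proof.
rewrite resistanceE linearB linearD /= trmxK linearMn /= mpinv_laplacian_sym.
by congr (_ - _); rewrite addrC.
Qed.

Lemma ones_gram : J *m J^T = n%:R%:M.
Proof.
rewrite tr_mxrow mul_mxrow_mxcol.
under eq_bigr do rewrite trmx1 mulmx1.
by rewrite sumr_const card_ord -raddfMn.
Qed.

Lemma rank_ones : (0 < n)%N -> \rank J = s.
Proof.
move=> n_gt0; apply/eqP; rewrite eqn_leq rank_leq_row /=.
(* [J] has the right inverse [n%:R^-1 *: J^T], so its rank is at least [s]. *)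
have := mxrankM_maxl J (n%:R^-1 *: J^T).
rewrite -scalemxAr ones_gram scale_scalar_mx mulVf ?mxrank1 //.
by rewrite pnatr_eq0 -lt0n.
Qed.

(** [D *m J] and its transpose contribute equally to a scalar. The factor [y *m J^T] is isolated
    because it vanishes on the complement of the range of [J]. *)
Lemma resistance_form (y : 'rV[R]_(\sum_(i < n) s)) :
  (y *m resistance G *m y^T) 0 0 =
  (y *m D *m (y *m J^T)^T) 0 0 *+ 2 - (y *m K *m y^T) 0 0 *+ 2.
Proof.
have formDJ (A : 'M_(_, s)) (B : 'M_(s, _)) :
    y *m (A *m B) *m y^T = y *m A *m (y *m B^T)^T.
  by rewrite trmx_mul trmxK !mulmxA.
have form_tr M : y *m M^T *m y^T = (y *m M *m y^T)^T.
  by rewrite !trmx_mul trmxK mulmxA.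
rewrite resistanceE mulmxBr mulmxBl mulmxDr mulmxDl form_tr formDJ !mulr2n.
by rewrite mulmxDr mulmxDl !mxE.
Qed.

Hypotheses (n_gt1 : (1 < n)%N) (G_connected : connected_graph G).

Let n_gt0 : (0 < n)%N := ltnW n_gt1.

Lemma mpinv_laplacian_block_form_gt0 (i : 'I_n) (x : 'rV[R]_s) :
  x != 0 -> 0 < (x *m submxblock K i i *m x^T) 0 0.
Proof.
move=> x0; pose E := \mxrow_(j < n) (if j == i then x else 0).
have <- : E *m K *m E^T = x *m submxblock K i i *m x^T.
  rewrite -[K in LHS]submxblockK /E tr_mxrow mul_mxrow_mxblock mul_mxrow_mxcol.
  rewrite (bigD1 i) //= eqxx [X in _ + X]big1 => [|j /negPf ->]; last first.
    by rewrite trmx0 mulmx0.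
  rewrite addr0 (bigD1 i) //= eqxx [X in _ + X]big1 ?addr0 // => j /negPf ->.
  by rewrite mul0mx.
apply: mpinv_laplacian_form_gt0 => // z.
rewrite mul_ones_rV /E => /eq_mxrowP Ez.
(* A block row in the range of [J] is constant; [E] is not, since a second vertex carries 0. *)
have [j ji] : exists j, j != i.
  have [->|i0] := eqVneq i (Ordinal n_gt0); first by exists (Ordinal n_gt1).
  by exists (Ordinal n_gt0); rewrite eq_sym.
have := Ez i; rewrite eqxx => xz.
by have := Ez j; rewrite (negPf ji) -xz => /esym/eqP; rewrite (negPf x0).
Qed.

Lemma resistance_form_ones_gt0 (x : 'rV[R]_s) :
  x != 0 -> 0 < (x *m J *m resistance G *m (x *m J)^T) 0 0.
Proof.
move=> x0; rewrite resistance_form.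
rewrite -(mulmxA x J K) mul_ones_mpinv_laplacian mulmx0 mul0mx [X in _ - X *+ 2]mxE.
rewrite mul0rn subr0 pmulrn_lgt0 //.
(* The [K] term is gone because [J K = 0]; [J J^T = n] leaves a positive multiple of the sum of the
   diagonal block forms. *)
rewrite -(mulmxA x J J^T) ones_gram mul_mx_scalar linearZ /= -scalemxAr mxE.
rewrite pmulr_rgt0 ?ltr0n // -(mulmxA x J D) mul_mxrow_mxcol.
rewrite mulmx_sumr mulmx_suml summxE (bigD1 (Ordinal n_gt0)) //= mul1mx.
rewrite ltr_pwDl ?mpinv_laplacian_block_form_gt0 //.
apply: sumr_ge0 => j _; rewrite mul1mx ltW //.
exact: mpinv_laplacian_block_form_gt0.
Qed.

Lemma resistance_form_lt0 (y : 'rV[R]_(\sum_(i < n) s)) :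
  y != 0 -> y *m J^T = 0 -> (y *m resistance G *m y^T) 0 0 < 0.
Proof.
move=> y0 yJ; rewrite resistance_form yJ trmx0 mulmx0 [X in X *+ 2 - _]mxE.
rewrite mul0rn sub0r oppr_lt0 pmulrn_lgt0 //.
(* If [y = z J], then [0 = y J^T = n z], so [y] would be zero. *)
apply: mpinv_laplacian_form_gt0 => // z yz; move: yJ y0.
rewrite yz -mulmxA ones_gram mul_mx_scalar => /eqP.
by rewrite scaler_eq0 pnatr_eq0 (gtn_eqF n_gt0) => /eqP ->; rewrite mul0mx eqxx.
Qed.

End Resistance.

Theorem theorem4p5 (R : realType) (n s : nat) (G : weighted_graph R n s)
    (n_gt1 : (1 < n)%N) (G_connected : connected_graph G) :
  has_inertia (resistance G) (s, (n * s - s)%N, 0%N).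
Proof.
set J := \mxrow_(i < n) (1%:M : 'M[R]_s).
have rkN : \rank (kermx J^T) = (n * s - s)%N.
  by rewrite mxrank_ker mxrank_tr rank_ones ?(ltnW n_gt1) // sum_nat_const card_ord.
(* The type of [row_base (kermx J^T)] gives it [\rank (kermx J^T)] rows, so the goal must name that
   number. *)
rewrite -rkN.
apply: (@inertia_of_definite_subspaces _ _ _ _ _ J (row_base (kermx J^T))).
- exact: resistance_sym.
(* The truncated subtraction is exact, as [s <= n * s] for positive [n]. *)
- by rewrite rkN sum_nat_const card_ord subnKC // leq_pmull // ltnW.
- by move=> x; apply: resistance_form_ones_gt0.
move=> x x0; apply: resistance_form_lt0 => //.
  apply: contraNneq x0 => xN0; apply/eqP.
  by apply: (row_free_inj (row_base_free (kermx J^T))); rewrite xN0 mul0mx.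
by apply/sub_kermxP; rewrite (submx_trans (submxMl _ _)) // eq_row_base.
Qed.
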